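(* With the notation of the context, let $\beta^*=\inf_{x\in\Delta}F(x)$, $\alpha^*=\inf_{x\in\Delta}G(x)$, let $x^*\in\Delta$ satisfy $F(x^* )=\beta^*$, and let $a^*,b^*,c^*\in(0,1)$ be such that $x^*(\psi)=a^*$ for $\psi$ of type 1, $x^*(\psi)=b^*$ for $\psi$ of type 2, 3 or 5, and $x^*(\psi)=c^*$ for $\psi$ of type 4. Then (i) $a^*=\dfrac{1}{(2n-1)\alpha_n+1}$, $b^*=\dfrac{(2n-1)(\alpha_n-1)}{(4n^2-4n-1)(2n-1)\alpha_n^2+2(2n^2-1)\alpha_n-(2n-1)}$, $c^*=\dfrac{2n-1}{2n-1+\alpha_n}$; (ii) $\beta^*=\alpha^*=\alpha_n$.
   Context: Fix an integer $n\ge2$ and free generators $\xi_1,\dots,\xi_n$ of a free group; throughout $i,j,k\in\{1,\dots,n\}$ and $t,s,p\in\{-1,+1\}$. Let $\Psi$ be the set of reduced words $\xi_i^{2t}$; $\xi_i^t\xi_j^{2s}$ ($i\ne j$); $\xi_i^t\xi_j^s\xi_k^p$ ($i\ne j$, $j\ne k$). Types: type 1 $=\xi_i^{2t}$; type 2 $=\xi_i^t\xi_j^{2s}$; type 3 $=\xi_i^t\xi_j^s\xi_i^t$; type 4 $=\xi_i^t\xi_j^s\xi_i^{-t}$; type 5 $=\xi_i^t\xi_j^s\xi_k^p$ with $i,j,k$ pairwise distinct. For a letter $\xi_a^x$ let $S(\xi_a^x)\subset\Psi$ be the set of words in $\Psi$ beginning with $\xi_a^x$, namely $\{\xi_a^{2x}\}\cup\{\xi_a^x\xi_j^{2s}\}\cup\{\xi_a^x\xi_j^s\xi_k^p\}$;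 for $a\ne b$ let $S(\xi_a^x\xi_b^y)=\{\xi_a^x\xi_b^{2y}\}\cup\{\xi_a^x\xi_b^y\xi_k^p: k\ne b\}$. A relation $r$ is a pair $(\psi_r,\Psi_r)$ with $\psi_r\in\Psi$, $\Psi_r\subseteq\Psi$; the relations considered are (indices $i_0\ne j_0$, in type 5 $i_0,j_0,k_0$ pairwise distinct, all signs arbitrary): 1a: $\psi_r=\xi_{i_0}^{2t_0}$, $\Psi_r=\Psi\setminus S(\xi_{i_0}^{t_0})$; 1b: $\psi_r=\xi_{i_0}^{2t_0}$, $\Psi_r=\Psi\setminus\{\xi_{i_0}^{t_0}\xi_{j_0}^{s_0}\xi_{i_0}^{t_0}\}$; 2a: $\psi_r=\xi_{i_0}^{t_0}\xi_{j_0}^{2s_0}$, $\Psi_r=\Psi\setminus\{\xi_{j_0}^{2s_0}\}$; 2b: $\psi_r=\xi_{i_0}^{t_0}\xi_{j_0}^{2s_0}$, $\Psi_r=\Psi\setminus S(\xi_{i_0}^{t_0}\xi_{j_0}^{s_0})$; 3a: $\psi_r=\xi_{i_0}^{t_0}\xi_{j_0}^{s_0}\xi_{i_0}^{t_0}$, $\Psi_r=\Psi\setminus S(\xi_{j_0}^{s_0}\xi_{i_0}^{t_0})$; 3b: $\psi_r=\xi_{i_0}^{t_0}\xi_{j_0}^{s_0}\xi_{i_0}^{t_0}$, $\Psi_r=\Psi\setminus\{\xi_{i_0}^{2t_0}\}$; 4a: $\psi_r=\xi_{i_0}^{t_0}\xi_{j_0}^{s_0}\xi_{i_0}^{-t_0}$,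 $\Psi_r=\Psi\setminus S(\xi_{j_0}^{s_0}\xi_{i_0}^{-t_0})$; 4b: $\psi_r=\xi_{i_0}^{t_0}\xi_{j_0}^{s_0}\xi_{i_0}^{-t_0}$, $\Psi_r=S(\xi_{i_0}^{t_0})$; 5a: $\psi_r=\xi_{i_0}^{t_0}\xi_{j_0}^{s_0}\xi_{k_0}^{p_0}$, $\Psi_r=\Psi\setminus S(\xi_{j_0}^{s_0}\xi_{k_0}^{p_0})$; 5b: $\psi_r=\xi_{i_0}^{t_0}\xi_{j_0}^{s_0}\xi_{k_0}^{p_0}$, $\Psi_r=\Psi\setminus S(\xi_{i_0}^{t_0}\xi_{k_0}^{p_0})$. Let $\mathcal{G}$ be the collection of all these relations and $\mathcal{F}\subset\mathcal{G}$ those of types 1a, 2b, 3a, 4b, 5a. Let $\Delta=\{x\in\mathbb{R}^\Psi: x(\psi)>0\ \forall\psi,\ \sum_{\psi}x(\psi)=1\}$. For a relation $r$ and $x\in\Delta$ put $x_r=x(\psi_r)$, $X_r=\sum_{\psi\in\Psi_r}x(\psi)$, $f_r(x)=\frac{1-x_r}{x_r}\cdot\frac{1-X_r}{X_r}$, $F(x)=\max_{r\in\mathcal{F}}f_r(x)$, $G(x)=\max_{r\in\mathcal{G}}f_r(x)$. The number $\alpha_n$ is the unique real root greater than $(2n-1)^2$ of $\mathcal{P}(\lambda)=(8n^3-12n^2+2n+1)\lambda^4+(-64n^6+192n^5-192n^4+64n^3+4n^2+2n-4)\lambda^3+(-96n^5+224n^4-168n^3+52n^2-18n+6)\lambda^2+(32n^5-112n^4+128n^3-68n^2+22n-4)\lambda+16n^4-32n^3+24n^2-8n+1.$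 *)

(* Defs.v *)
From HB Require Import structures.
From mathcomp Require Import all_boot all_order all_algebra.
From mathcomp Require Import boolp classical_sets reals.
Set Implicit Arguments. Unset Strict Implicit. Unset Printing Implicit Defensive.
Import Order.TTheory GRing.Theory Num.Theory.
Local Open Scope ring_scope.

(* A letter xi_i^t : generator index i and sign t (true = +1, false = -1). *)
Definition letter (n : nat) := ('I_n * bool)%type.
Definition flip n (a : letter n) : letter n := (a.1, ~~ a.2).

(* Raw words: inl (inl a)      = a a      (i.e. xi_i^{2t})
              inl (inr (a,b))  = a b b    (i.e. xi_i^t xi_j^{2s})
              inr (a,b,c)      = a b c    (i.e. xi_i^t xi_j^s xi_k^p) *)
Definition psi_raw (n : nat) :=
  ((letter n + (letter n * letter n)) + (letter n * letter n * letter n))%type.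

Definition inPsi n (w : psi_raw n) : bool :=
  match w with
  | inl (inl _) => true
  | inl (inr (a, b)) => a.1 != b.1
  | inr (a, b, c) => (a.1 != b.1) && (b.1 != c.1)
  end.

Definition psi_type n (w : psi_raw n) : nat :=
  match w with
  | inl (inl _) => 1
  | inl (inr _) => 2
  | inr (a, b, c) =>
      if c == a then 3 else if c == flip a then 4 else 5
  end.

Definition S1 n (a : letter n) (w : psi_raw n) : bool :=
  inPsi w &&
  match w with
  | inl (inl a') => a' == a
  | inl (inr (a', _)) => a' == a
  | inr (a', _, _) => a' == a
  end.

Definition S2 n (a b : letter n) (w : psi_raw n) : bool :=
  inPsi w &&
  match w with
  | inl (inl _) => false
  | inl (inr (a', b')) => (a' == a) && (b' == b)
  | inr (a', b', _) => (a' == a) && (b' == b)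
  end.

Inductive rkind := R1a | R1b | R2a | R2b | R3a | R3b | R4a | R4b | R5a | R5b.

(* Parameters of a relation: a = xi_{i0}^{t0}, b = xi_{j0}^{s0},
   c = xi_{k0}^{p0} (c only used in type 5). *)
Definition rel_valid n (k : rkind) (p : letter n * letter n * letter n) : bool :=
  let: (a, b, c) := p in
  match k with
  | R5a | R5b => [&& a.1 != b.1, b.1 != c.1 & a.1 != c.1]
  | _ => a.1 != b.1
  end.

Definition rel_psi n (k : rkind) (p : letter n * letter n * letter n) : psi_raw n :=
  let: (a, b, c) := p in
  match k with
  | R1a | R1b => inl (inl a)
  | R2a | R2b => inl (inr (a, b))
  | R3a | R3b => inr (a, b, a)
  | R4a | R4b => inr (a, b, flip a)
  | R5a | R5b => inr (a, b, c)
  end.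

Definition rel_Psi n (k : rkind) (p : letter n * letter n * letter n)
  (w : psi_raw n) : bool :=
  let: (a, b, c) := p in
  inPsi w &&
  match k with
  | R1a => ~~ S1 a w
  | R1b => w != inr (a, b, a)
  | R2a => w != inl (inl b)
  | R2b => ~~ S2 a b w
  | R3a => ~~ S2 b a w
  | R3b => w != inl (inl a)
  | R4a => ~~ S2 b (flip a) w
  | R4b => S1 a w
  | R5a => ~~ S2 b c w
  | R5b => ~~ S2 a c w
  end.

Section Real.
Variable R : realType.

Definition Delta n : set (psi_raw n -> R) :=
  [set x | (forall w, inPsi w -> 0 < x w) /\ \sum_(w | inPsi w) x w = 1].

Definition f_rel n (k : rkind) (p : letter n * letter n * letter n)
  (x : psi_raw n -> R) : R :=
  let xr := x (rel_psi k p) in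
  let Xr := \sum_(w | rel_Psi k p w) x w in
  (1 - xr) / xr * ((1 - Xr) / Xr).

Definition maxrel n (ks : seq rkind) (x : psi_raw n -> R) : R :=
  \big[Num.max/0]_(k <- ks)
    \big[Num.max/0]_(p : letter n * letter n * letter n | rel_valid k p)
      f_rel k p x.

Definition Fmax n (x : psi_raw n -> R) : R := maxrel [:: R1a; R2b; R3a; R4b; R5a] x.
Definition Gmax n (x : psi_raw n -> R) : R :=
  maxrel [:: R1a; R1b; R2a; R2b; R3a; R3b; R4a; R4b; R5a; R5b] x.

Definition Ppoly (n : nat) (l : R) : R :=
  let N := n%:R : R in
  (8 * N ^+ 3 - 12 * N ^+ 2 + 2 * N + 1) * l ^+ 4
  + (- 64 * N ^+ 6 + 192 * N ^+ 5 - 192 * N ^+ 4 + 64 * N ^+ 3 + 4 * N ^+ 2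
     + 2 * N - 4) * l ^+ 3
  + (- 96 * N ^+ 5 + 224 * N ^+ 4 - 168 * N ^+ 3 + 52 * N ^+ 2 - 18 * N + 6)
    * l ^+ 2
  + (32 * N ^+ 5 - 112 * N ^+ 4 + 128 * N ^+ 3 - 68 * N ^+ 2 + 22 * N - 4) * l
  + (16 * N ^+ 4 - 32 * N ^+ 3 + 24 * N ^+ 2 - 8 * N + 1).

End Real.

(* Main.v *)
(* On weights that depend only on the type of a word, [Fmax] is the maximum of
   three odds products f1(a), f2(b, c), f4(c); f1 and f4 decrease in a and c, and
   f2 increases in c.  The stated values a0, b0, c0 solve f1 = f2 = f4 = alpha, and
   P(alpha) = 0 expresses that they have total mass one, so they give a point of
   the simplex with F = alpha.  A symmetric minimizer has F <= alpha, hence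
   a >= a0, c >= c0 and, by total mass, b <= b0; but b |-> f2(b, c0) is strictly
   decreasing up to b0, which forces b = b0 and then equality throughout.  At this
   point the relations of G outside F have value at most alpha, so inf G = alpha
   as well. *)
Require Import Defs.
From HB Require Import structures.
From mathcomp Require Import all_boot all_order all_algebra.
From mathcomp Require Import boolp classical_sets reals.
From mathcomp Require Import ring lra.
Import Order.TTheory GRing.Theory Num.Theory.
Local Open Scope ring_scope.
Local Open Scope classical_set_scope.

(** * Sums over words *)

Definition first_letter {n} (w : psi_raw n) : letter n :=
  match w with
  | inl (inl l) => l
  | inl (inr (l, _)) => l
  | inr (l, _, _) => l
  end.

Lemma S1E {n} (l : letter n) (w : psi_raw n) :
  S1 l w = inPsi w && (first_letter w == l).
Proof. by case: w => [[?|[??]]|[[??]?]]. Qed.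

Lemma sum_pair {V : nmodType} {I J : finType} (P : pred I) (Q : I -> pred J)
    (F : I * J -> V) :
  \sum_(p | P p.1 && Q p.1 p.2) F p = \sum_(i | P i) \sum_(j | Q i j) F (i, j).
Proof. by rewrite pair_big_dep; apply: eq_bigr => -[]. Qed.

Lemma sum_S1 {V : nmodType} {n} (l : letter n) (x : psi_raw n -> V) :
  \sum_(w | S1 l w) x w =
  x (inl (inl l)) + \sum_(j | l.1 != j.1)
    (x (inl (inr (l, j))) + \sum_(k | j.1 != k.1) x (inr (l, j, k))).
Proof.
rewrite !big_sumType /= (eq_bigl (pred1 l)); last by move=> i; rewrite S1E.
rewrite big_pred1_eq -addrA big_split /=; congr (_ + (_ + _)).
  rewrite (eq_bigl (fun p => (p.1 == l) && (p.1.1 != p.2.1))); last first.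
    by move=> [i j]; rewrite S1E /= andbC.
  by rewrite (sum_pair (pred1 l) (fun i j => i.1 != j.1)) big_pred1_eq.
rewrite (eq_bigl (fun p => ((p.1.1 == l) && (p.1.1.1 != p.1.2.1))
    && (p.1.2.1 != p.2.1))); last first.
  by move=> [[i j] k]; rewrite S1E /= andbC andbA.
rewrite (sum_pair (fun p => (p.1 == l) && (p.1.1 != p.2.1))
  (fun p k => p.2.1 != k.1)).
by rewrite (sum_pair (pred1 l) (fun i j => i.1 != j.1)) big_pred1_eq.
Qed.

Lemma sum_S2 {V : nmodType} {n} (l j : letter n) (x : psi_raw n -> V) :
  l.1 != j.1 ->
  \sum_(w | S2 l j w) x w =
  x (inl (inr (l, j))) + \sum_(k | j.1 != k.1) x (inr (l, j, k)).
Proof.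
move=> lj; rewrite !big_sumType /= big_pred0_eq add0r; congr (_ + _).
  rewrite (eq_bigl (pred1 (l, j))) ?big_pred1_eq // => -[u v] /=.
  rewrite xpair_eqE /S2 /=.
  by have [->|] := eqVneq u l; have [->|] := eqVneq v j; rewrite ?lj ?andbF.
rewrite (eq_bigl (fun p => (p.1 == (l, j)) && (j.1 != p.2.1))); last first.
  move=> [[u v] k] /=; rewrite xpair_eqE /S2 /=.
  by have [->|] := eqVneq u l; have [->|] := eqVneq v j;
    rewrite ?lj ?andbF ?andbT.
by rewrite (sum_pair (pred1 (l, j)) (fun _ k => j.1 != k.1)) big_pred1_eq.
Qed.

Lemma sum_inPsi {V : nmodType} {n} (x : psi_raw n -> V) :
  \sum_(w | inPsi w) x w = \sum_l \sum_(w | S1 l w) x w.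
Proof.
rewrite (partition_big first_letter xpredT) //=.
by apply: eq_bigr => l _; apply: eq_bigl => w; rewrite S1E.
Qed.

(** There are [2 * (n - 1)] such letters. The count is written in the ring, so that [ring] and [lra]
    meet no truncated subtraction. *)
Lemma sum_letter_const {R : pzRingType} {n} (i : 'I_n) (v : R) :
  \sum_(k : letter n | i != k.1) v = (2 * n%:R - 2) * v.
Proof.
rewrite (eq_bigl (fun p => (i != p.1) && true)) => [|k]; last by rewrite andbT.
rewrite (sum_pair (fun j => i != j) (fun=> xpredT)) /=.
rewrite (eq_bigr (fun=> v *+ 2)) => [|j _]; last by rewrite sumr_const card_bool.
rewrite sumr_const (eq_card (B := predC1 i)) => [|j]; last by rewrite !inE eq_sym.
rewrite cardC1 card_ord -mulrnA -[LHS]mulr_natl natrM; congr (_ * _).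
by case: n i => [[]//|n] _ /=; rewrite -[n.+1]addn1 natrD mulrDr mulr1 addrK.
Qed.

(** * Weights depending only on the type of a word *)

Definition type_weight {R : Type} (a b c : R) (t : nat) : R :=
  if t == 1%N then a else if t == 4%N then c else b.

Definition symmetric_weight {R : Type} {n} (x : psi_raw n -> R) (a b c : R) :=
  forall w, inPsi w -> x w = type_weight a b c (psi_type w).

(** This is the value of a relation with [u] the weight of its word and [q] the mass of the
    complement of its set, which is usually the simpler sum. *)
Definition odds_ratio {R : fieldType} (u q : R) : R :=
  (1 - u) / u * (q / (1 - q)).

Section SymmetricWeight.
Variables (R : realType) (n : nat) (x : psi_raw n -> R) (a b c : R).
Hypothesis xE : symmetric_weight x a b c.
Let N := n%:R : R.

(** Among the admissible third letters only [flip l] gives type 4 and weight [c]; all others give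
    weight [b]. *)
Lemma sum_third (l j : letter n) : l.1 != j.1 ->
  \sum_(k | j.1 != k.1) x (inr (l, j, k)) = (2 * N - 2) * b + (c - b).
Proof.
move=> lj; rewrite (eq_bigr (fun k => b + if k == flip l then c - b else 0)).
  rewrite big_split /= sum_letter_const; congr (_ + _).
  rewrite (bigD1 (flip l)) /=; last by rewrite eq_sym.
  by rewrite eqxx big1 ?addr0 // => k /andP[_ /negbTE->].
move=> k jk; rewrite xE /= ?lj //.
have [->|kl] := eqVneq k l.
  suff /negbTE-> : l != flip l by rewrite addr0.
  by case: l {lj} => i []; rewrite xpair_eqE eqxx.
by case: eqP => _; rewrite /type_weight /= ?addr0 // addrC subrK.
Qed.

Lemma sum_S2_symmetric (l j : letter n) : l.1 != j.1 ->
  \sum_(w | S2 l j w) x w = (2 * N - 2) * b + c.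
Proof.
by move=> lj; rewrite sum_S2 // sum_third // xE //= /type_weight /=; ring.
Qed.

Lemma sum_S1_symmetric (l : letter n) :
  \sum_(w | S1 l w) x w =
  a + (2 * N - 2) * c + (2 * N - 2) ^+ 2 * b.
Proof.
rewrite sum_S1 xE // (eq_bigr (fun=> (2 * N - 2) * b + c)).
  by rewrite sum_letter_const /type_weight /=; ring.
by move=> j lj; rewrite sum_third // xE //= /type_weight /=; ring.
Qed.

Lemma sum_inPsi_symmetric :
  \sum_(w | inPsi w) x w =
  2 * N * (a + (2 * N - 2) * c + (2 * N - 2) ^+ 2 * b).
Proof.
rewrite sum_inPsi (eq_bigr _ (fun l _ => sum_S1_symmetric l)) sumr_const.
by rewrite card_prod card_ord card_bool -[LHS]mulr_natl natrM [_ * 2]mulrC.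
Qed.

Hypothesis x1 : \sum_(w | inPsi w) x w = 1.

Lemma mass_compl (A : pred (psi_raw n)) : subpred A (@inPsi n) ->
  1 - \sum_(w | inPsi w && ~~ A w) x w = \sum_(w | A w) x w.
Proof.
move=> AP; rewrite -x1 (bigID A) /= addrK; apply: eq_bigl => w.
by case: (boolP (A w)) => [/AP->|]; rewrite ?andbF.
Qed.

Lemma mass_singleton (w0 : psi_raw n) : inPsi w0 ->
  1 - \sum_(w | inPsi w && (w != w0)) x w = x w0.
Proof.
move=> w0P; rewrite -(big_pred1_eq +%R w0 x) -(mass_compl (pred1 w0)) //.
by move=> w /eqP->.
Qed.

(** By symmetry the classes of words with a given first letter have equal mass, and there are
    [2 * n] of them; the letter [l] ensures [n > 0]. *)
Lemma mass_S1 (l : letter n) : \sum_(w | S1 l w) x w = 1 / (2 * N).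
Proof.
have N0 : 2 * N != 0; last first.
  by rewrite div1r -[LHS](mulKf N0) sum_S1_symmetric -sum_inPsi_symmetric x1 mulr1.
by rewrite mulf_neq0 ?pnatr_eq0 //; case: n l => // -[[]].
Qed.

Lemma f_relE k p : rel_valid k p -> f_rel k p x =
  match k with
  | R1a => odds_ratio a (1 / (2 * N))
  | R1b => odds_ratio a b
  | R2a | R3b => odds_ratio b a
  | R2b | R3a | R5a | R5b => odds_ratio b ((2 * N - 2) * b + c)
  | R4a => odds_ratio c ((2 * N - 2) * b + c)
  | R4b => odds_ratio c (1 - 1 / (2 * N))
  end.
Proof.
pose q := 1 - \sum_(w | rel_Psi k p w) x w.
have -> : f_rel k p x = odds_ratio (x (rel_psi k p)) q.
  by rewrite /f_rel /odds_ratio subKr.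
have S1P l : subpred (@S1 n l) (@inPsi n) by move=> w /andP[].
have S2P l j : subpred (@S2 n l j) (@inPsi n) by move=> w /andP[].
have flipN (l : letter n) : flip l == l = false.
  by case: l => i []; rewrite xpair_eqE eqxx.
case: p @q => -[u v] w; case: k => /= uv.
- by rewrite mass_compl // mass_S1 xE.
- by rewrite mass_singleton ?xE /= ?eqxx // uv eq_sym uv.
- by rewrite mass_singleton ?xE.
- by rewrite mass_compl // sum_S2_symmetric ?xE.
- have vu : v.1 != u.1 by rewrite eq_sym.
  by rewrite mass_compl // sum_S2_symmetric // xE /= ?eqxx ?uv.
- have vu : v.1 != u.1 by rewrite eq_sym.
  by rewrite mass_singleton // !xE /= ?eqxx ?uv.
- have vu : v.1 != u.1 by rewrite eq_sym.
  by rewrite mass_compl // sum_S2_symmetric // xE /= ?flipN ?eqxx ?uv.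
- have vu : v.1 != u.1 by rewrite eq_sym.
  rewrite (eq_bigl (S1 u)) => [|z]; last by rewrite /S1; case: inPsi.
  by rewrite mass_S1 xE /= ?flipN ?eqxx ?uv.
all: have /and3P[uv1 vw uw] := uv.
all: have wu : w == u = false by apply/eqP => e; rewrite e eqxx in uw.
all: have wfu : w == flip u = false by apply/eqP => e; rewrite e eqxx in uw.
all: by rewrite mass_compl // sum_S2_symmetric // xE /= ?wu ?wfu ?uv1.
Qed.

End SymmetricWeight.

(** * The three-parameter problem *)

Definition opt2_den {R : fieldType} (N l : R) : R :=
  (4 * N ^+ 2 - 4 * N - 1) * (2 * N - 1) * l ^+ 2
  + 2 * (2 * N ^+ 2 - 1) * l - (2 * N - 1).

Definition opt1 {R : fieldType} (N l : R) : R := 1 / ((2 * N - 1) * l + 1).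
Definition opt2 {R : fieldType} (N l : R) : R := (2 * N - 1) * (l - 1) / opt2_den N l.
Definition opt4 {R : fieldType} (N l : R) : R := (2 * N - 1) / (2 * N - 1 + l).

Section Optimum.
Variable R : realFieldType.
Implicit Types u v q N : R.

Lemma odds_ratio_le_mass u q q' : 0 < u < 1 -> q <= q' < 1 ->
  odds_ratio u q <= odds_ratio u q'.
Proof.
move=> /andP[u0 u1] /andP[qq' q1]; apply: ler_wpM2l.
  by apply: divr_ge0; lra.
rewrite ler_pdivrMr ?subr_gt0 ?(le_lt_trans qq') // mulrAC ler_pdivlMr ?subr_gt0 //.
by lra.
Qed.

Lemma odds_ratio_le u u' q q' : 0 < u -> 0 < u' -> q < 1 -> q' < 1 ->
  odds_ratio u q <= odds_ratio u' q' ->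
  (1 - u) * q * (u' * (1 - q')) <= (1 - u') * q' * (u * (1 - q)).
Proof.
move=> u0 u'0 q1 q'1; rewrite /odds_ratio !mulf_div.
by rewrite ler_pdivrMr ?mulr_gt0 ?subr_gt0 // mulrAC ler_pdivlMr ?mulr_gt0 ?subr_gt0.
Qed.

Lemma odds_ratio_anti u u' q : 0 < u -> 0 < u' -> 0 < q < 1 ->
  odds_ratio u q <= odds_ratio u' q -> u' <= u.
Proof.
move=> u0 u'0 /andP[q0 q1] /odds_ratio_le => /(_ u0 u'0 q1 q1) le.
have : (q * (1 - q)) * u' <= (q * (1 - q)) * u by lra.
by rewrite ler_pM2l // mulr_gt0 // subr_gt0.
Qed.

(** Lower bounds on [a] and [c] become an upper bound on [b] through the total mass. The second odds
    product then gives the reverse bound on [b]; [b0 <= c0] provides the monotonicity this takes. *)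
Lemma optimum_unique N a b c a0 b0 c0 : let k := 2 * N - 2 in
  2 <= N -> 0 < a -> 0 < b -> 0 < c -> 0 < a0 -> 0 < b0 -> 0 < c0 ->
  b0 <= c0 ->
  2 * N * (a + k * c + k ^+ 2 * b) = 1 ->
  2 * N * (a0 + k * c0 + k ^+ 2 * b0) = 1 ->
  odds_ratio a (1 / (2 * N)) <= odds_ratio a0 (1 / (2 * N)) ->
  odds_ratio b (k * b + c) <= odds_ratio b0 (k * b0 + c0) ->
  odds_ratio c (1 - 1 / (2 * N)) <= odds_ratio c0 (1 - 1 / (2 * N)) ->
  [/\ a = a0, b = b0 & c = c0].
Proof.
move=> k N2 a_gt0 b_gt0 c_gt0 a0_gt0 b0_gt0 c0_gt0 bc0 tot tot0 fa fb fc.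
have k2 : 2 <= k by rewrite /k; lra.
have h_gt0 : 0 < 1 / (2 * N) by rewrite divr_gt0 //; lra.
have h_le : 1 / (2 * N) <= 4^-1 by rewrite mul1r lef_pV2 ?posrE; lra.
have N0 : 2 * N != 0 by apply/eqP; lra.
have totE : a + k * c + k ^+ 2 * b = 1 / (2 * N).
  by rewrite div1r -[LHS](mulKf N0) tot mulr1.
have tot0E : a0 + k * c0 + k ^+ 2 * b0 = 1 / (2 * N).
  by rewrite div1r -[LHS](mulKf N0) tot0 mulr1.
have aa0 : a0 <= a by apply: odds_ratio_anti fa => //; lra.
have cc0 : c0 <= c by apply: odds_ratio_anti fc => //; lra.
have k_gt0 : 0 < k by lra.
have kk_gt0 : 0 < k ^+ 2 by rewrite exprn_gt0.
have bb0 : b <= b0.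
  rewrite -(ler_pM2l kk_gt0); have : k * c0 <= k * c by rewrite ler_pM2l.
  by lra.
have kc_gt0 : 0 < k * c by rewrite mulr_gt0.
have kc0_gt0 : 0 < k * c0 by rewrite mulr_gt0.
have kkb_gt0 : 0 < k ^+ 2 * b by rewrite mulr_gt0.
have kkb0_gt0 : 0 < k ^+ 2 * b0 by rewrite mulr_gt0.
(* Multiply by [k]: the hypothesis bounds [k * (k * B + C)] by 1/4, and [k >= 2]. *)
have s_le B C : 0 < B -> 0 < C -> k * C + k ^+ 2 * B <= 4^-1 ->
    k * B + C <= 8^-1.
  move=> B_gt0 C_gt0 le; rewrite -(ler_pM2l k_gt0).
  by rewrite mulrDr mulrA -expr2; lra.
have s_lt : k * b + c <= 8^-1 by apply: s_le => //; lra.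
have s0_lt : k * b0 + c0 <= 8^-1 by apply: s_le => //; lra.
have kb_gt0 : 0 < k * b by rewrite mulr_gt0.
have kb0_gt0 : 0 < k * b0 by rewrite mulr_gt0.
(* Lowering [c] to [c0] only lowers the left side, so [b] is the single remaining unknown. *)
have {fb} le : odds_ratio b (k * b + c0) <= odds_ratio b0 (k * b0 + c0).
  apply: le_trans fb; apply: odds_ratio_le_mass.
    apply/andP; split=> //; apply: le_lt_trans bb0 _; lra.
  by apply/andP; split; lra.
have {le} := odds_ratio_le _ _ _ _ b_gt0 b0_gt0 _ _ le.
have kbc : k * b + c0 < 1 by lra.
have kbc' : k * b0 + c0 < 1 by lra.
move=> /(_ kbc kbc') le.
(* After clearing denominators, [le] reads [(b0 - b) * m <= 0]. *)
pose m := c0 * (1 - c0) - k * c0 * (b + b0) - k * (k - 1) * b * b0.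
(* The factor of [c0] is at least 1/2, while [(k ^+ 2 - k) * b <= 1/4] and [b0 <= c0]; hence
   [m >= c0 / 4]. *)
have m_gt0 : 0 < m.
  have -> : m = c0 * (1 - c0 - k * b - k * b0) - (k ^+ 2 - k) * b * b0.
    by rewrite /m; ring.
  have e1 : c0 * 2^-1 <= c0 * (1 - c0 - k * b - k * b0) by rewrite ler_pM2l //; lra.
  have e2 : (k ^+ 2 - k) * b * b0 <= 4^-1 * c0.
    by apply: ler_pM => //; [apply: mulr_ge0; nra | lra | nra].
  by lra.
have : (b0 - b) * m <= 0 by rewrite /m; lra.
rewrite pmulr_lle0 // subr_le0 => b0b.
have eb : b = b0 by apply: le_anti; rewrite bb0.
have kcc0 : k * c0 <= k * c by rewrite ler_pM2l.
(* Once [b = b0], equal totals turn [a0 <= a] and [c0 <= c] into equalities. *)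
move: totE; rewrite eb => totE.
have ea : a = a0 by lra.
split=> //; apply: (mulfI (lt0r_neq0 k_gt0)); lra.
Qed.

(** * Positivity and comparison of the stated values *)

Section Bounds.
Variables N l : R.
Hypotheses (N_ge2 : 2 <= N) (l_gtm2 : (2 * N - 1) ^+ 2 < l).

Lemma opt_bounds :
  [/\ 2 <= N, 9 < l, 3 <= 2 * N - 1 & 27 <= (2 * N - 1) * l].
Proof.
have N2 := N_ge2; have l9 : 9 < l by apply: le_lt_trans l_gtm2; nra.
by split=> //; [lra|nra].
Qed.

(** For [N >= 2] the factor [4 * N ^+ 2 - 4 * N - 1] is at least 7, and the terms of lower degree in
    [l] have positive sum. *)
Lemma opt2_den_gt : 7 * (2 * N - 1) * l ^+ 2 < opt2_den N l.
Proof.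
have [N2 l9 m3 ml27] := opt_bounds.
have : 7 * ((2 * N - 1) * l ^+ 2) <=
       (4 * N ^+ 2 - 4 * N - 1) * ((2 * N - 1) * l ^+ 2).
  by apply: ler_wpM2r; [apply: mulr_ge0; [lra|exact: sqr_ge0]|nra].
have h7 : 7 <= 2 * N ^+ 2 - 1 by nra.
have : (2 * N ^+ 2 - 1) * 1 <= (2 * N ^+ 2 - 1) * l by rewrite ler_pM2l; lra.
have : 2 * N - 1 <= 2 * N ^+ 2 - 1 by nra.
by rewrite /opt2_den; lra.
Qed.

Lemma opt2_den_gt0 : 0 < opt2_den N l.
Proof.
have [N2 l9 m3 ml27] := opt_bounds.
by apply: le_lt_trans opt2_den_gt; apply: mulr_ge0; [lra|exact: sqr_ge0].
Qed.

Lemma opt1_gt0 : 0 < opt1 N l.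
Proof. by have [N2 l9 m3 ml27] := opt_bounds; apply: divr_gt0; lra. Qed.

Lemma opt4_gt0 : 0 < opt4 N l.
Proof. by have [N2 l9 m3 ml27] := opt_bounds; apply: divr_gt0; lra. Qed.

Lemma opt2_gt0 : 0 < opt2 N l.
Proof.
have [N2 l9 m3 ml27] := opt_bounds.
by apply: divr_gt0 opt2_den_gt0; apply: mulr_gt0; lra.
Qed.

Lemma opt1_le_opt4 : opt1 N l <= opt4 N l.
Proof.
have [N2 l9 m3 ml27] := opt_bounds.
rewrite /opt1 /opt4 ler_pdivrMr; last lra.
by rewrite mulrAC ler_pdivlMr; nra.
Qed.

Lemma opt2_le_opt4 : opt2 N l <= opt4 N l.
Proof.
have [N2 l9 m3 ml27] := opt_bounds; have D_gt := opt2_den_gt.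
rewrite /opt2 /opt4 ler_pdivrMr; last exact: opt2_den_gt0.
rewrite mulrAC ler_pdivlMr; last lra.
rewrite -mulrA ler_pM2l; last lra.
apply: le_trans (ltW D_gt).
(* What remains is [(l - 1) * (2 * N - 1 + l)] against the quadratic bound; each product is
   dominated by [(2 * N - 1) * l ^+ 2]. *)
have : (2 * N - 1) * l <= (2 * N - 1) * l ^+ 2.
  by rewrite expr2 mulrA ler_peMr; lra.
have : 1 * l ^+ 2 <= (2 * N - 1) * l ^+ 2.
  by rewrite ler_wpM2r ?sqr_ge0 //; lra.
by lra.
Qed.

Lemma odds_ratio_opt1 : odds_ratio (opt1 N l) (1 / (2 * N)) = l.
Proof.
have [N2 l9 m3 ml27] := opt_bounds.
by rewrite /odds_ratio /opt1; field; repeat (apply/andP; split); apply/eqP; lra.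
Qed.

Lemma odds_ratio_opt4 : odds_ratio (opt4 N l) (1 - 1 / (2 * N)) = l.
Proof.
have [N2 l9 m3 ml27] := opt_bounds.
by rewrite /odds_ratio /opt4; field; repeat (apply/andP; split); apply/eqP; lra.
Qed.

End Bounds.
End Optimum.

(** * Consequences of the polynomial equation *)

Section CriticalValue.
Variables (R : realType) (n : nat) (l : R).
Let N := n%:R : R.
Hypotheses (N_ge2 : 2 <= N) (l_gtm2 : (2 * N - 1) ^+ 2 < l) (Pl : Ppoly n l = 0).

(* [opt2] solves [odds_ratio (opt2 N l) s = l] for the mass [s] on the right,
   which is forced by [opt1] and total mass one; [Ppoly n l = 0] says that this
   mass is also the one computed from [opt2] and [opt4]. *)
Lemma opt_mass : (2 * N - 2) * opt2 N l + opt4 N l =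
  (2 * N - 1) * (l - 1) / (2 * N * (2 * N - 2) * ((2 * N - 1) * l + 1)).
Proof.
have [N2 l9 m3 ml27] := opt_bounds _ _ _ N_ge2 l_gtm2.
have D0 := lt0r_neq0 (opt2_den_gt0 _ _ _ N_ge2 l_gtm2).
have m0 : 2 * N - 1 + l != 0 by apply/eqP; lra.
have E0 : 2 * N * (2 * N - 2) * ((2 * N - 1) * l + 1) != 0.
  by rewrite !mulf_neq0 //; apply/eqP; lra.
apply/eqP; rewrite /opt2 /opt4 mulrA addf_div // eqr_div ?E0 ?mulf_neq0 //.
(* The difference of the cross products is a multiple of the polynomial. *)
rewrite -subr_eq0; apply/eqP; transitivity (- (2 * N - 1) * Ppoly n l).
  by rewrite /opt2_den /Ppoly; ring.
by rewrite Pl mulr0.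
Qed.

Lemma opt_total :
  2 * N * (opt1 N l + (2 * N - 2) * opt4 N l + (2 * N - 2) ^+ 2 * opt2 N l) = 1.
Proof.
have [N2 l9 m3 ml27] := opt_bounds _ _ _ N_ge2 l_gtm2.
have -> : opt1 N l + (2 * N - 2) * opt4 N l + (2 * N - 2) ^+ 2 * opt2 N l =
    opt1 N l + (2 * N - 2) * ((2 * N - 2) * opt2 N l + opt4 N l) by ring.
rewrite opt_mass /opt1; field.
by repeat (apply/andP; split); apply/eqP; lra.
Qed.

Lemma odds_ratio_opt2 :
  odds_ratio (opt2 N l) ((2 * N - 2) * opt2 N l + opt4 N l) = l.
Proof.
have [N2 l9 m3 ml27] := opt_bounds _ _ _ N_ge2 l_gtm2.
have D0 := lt0r_neq0 (opt2_den_gt0 _ _ _ N_ge2 l_gtm2).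
rewrite opt_mass /odds_ratio /opt2.
set p := (2 * N - 1) * (l - 1).
set E := 2 * N * (2 * N - 2) * ((2 * N - 1) * l + 1).
(* The mass is [p / E] and [opt2] is [p / (p + l * (E - p))], so the two odds are [l * (E - p) / p]
   and [p / (E - p)], with product [l]. *)
have DE : opt2_den N l = p + l * (E - p) by rewrite /opt2_den /p /E; ring.
have p0 : p != 0 by rewrite mulf_neq0 //; apply/eqP; lra.
have E_gt : p < E.
  have : p < (2 * N - 1) * l + 1 by rewrite /p; lra.
  move/lt_le_trans; apply; rewrite ler_peMl; nra.
have p_gt0 : 0 < p by rewrite mulr_gt0; lra.
rewrite DE in D0 *; field.
by rewrite D0 p0 /= !lt0r_neq0; lra.
Qed.

End CriticalValue.

(** * Maxima over relations *)

Section MaxRel.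
Variables (R : realType) (n : nat).
Implicit Types (ks : seq rkind) (x : psi_raw n -> R).

Lemma maxrel_ge0 ks x : 0 <= maxrel ks x.
Proof.
rewrite /maxrel; elim/big_rec: _ => // k y _ y0.
by rewrite le_max y0 orbT.
Qed.

(** The condition [0 <= l] accounts for the default value 0 of the maxima. *)
Lemma maxrel_le ks x l : 0 <= l ->
  (forall k p, rel_valid k p -> f_rel k p x <= l) -> maxrel ks x <= l.
Proof.
by move=> l0 le; apply: bigmax_le => // k _; apply: bigmax_le => // p /le.
Qed.

(** These three kinds supply the three inequalities for a symmetric minimizer; on symmetric weights
    kinds 3a and 5a give the same value as 2b. *)
Lemma f_rel_le_Fmax k p x :
  match k with R1a | R2b | R4b => true | _ => false end -> rel_valid k p ->
  f_rel k p x <= Fmax x.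
Proof.
move=> kF kp; apply: le_trans (le_bigmax_cond 0 (fun p => f_rel k p x) kp) _.
by rewrite /Fmax /maxrel !big_cons big_nil !le_max; case: k kF {kp};
  rewrite ?lexx ?orbT.
Qed.

(** Serves to compare [Fmax] with [Gmax], as the kinds of the former are a subsequence of those of
    the latter. *)
Lemma maxrel_mask ms ks x : maxrel (mask ms ks) x <= maxrel ks x.
Proof.
elim: ks ms => [|k ks IH] [|b ms] //=; first by rewrite /maxrel big_nil maxrel_ge0.
case: b; rewrite /maxrel !big_cons; first exact: le_max2 (lexx _) (IH ms).
by rewrite le_max IH orbT.
Qed.

Lemma Fmax_le_Gmax x : Fmax x <= Gmax x.
Proof.
exact: (maxrel_mask [:: true; false; false; true; true; false; false; true; true]
  [:: R1a; R1b; R2a; R2b; R3a; R3b; R4a; R4b; R5a; R5b]).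
Qed.

Lemma has_lbound_Fmax : has_lbound [set Fmax x | x in @Delta R n].
Proof. by exists 0 => _ [x _ <-]; apply: maxrel_ge0. Qed.

Lemma has_lbound_Gmax : has_lbound [set Gmax x | x in @Delta R n].
Proof. by exists 0 => _ [x _ <-]; apply: maxrel_ge0. Qed.

End MaxRel.

(** * The candidate minimizer and its value under all relations *)

Section OptimalWeight.
Variables (R : realType) (n : nat) (l : R).
Let N := n%:R : R.
Hypotheses (n_ge2 : (2 <= n)%N) (l_gtm2 : (2 * N - 1) ^+ 2 < l)
  (Pl : Ppoly n l = 0).

Let N_ge2 : 2 <= N. Proof. by rewrite ler_nat. Qed.

Definition opt_weight (w : psi_raw n) : R :=
  type_weight (opt1 N l) (opt2 N l) (opt4 N l) (psi_type w).

Lemma opt_weight_symmetric :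
  symmetric_weight opt_weight (opt1 N l) (opt2 N l) (opt4 N l).
Proof. by []. Qed.

Lemma opt_weight_Delta : Delta opt_weight.
Proof.
split=> [w _|]; last first.
  by rewrite (sum_inPsi_symmetric _ _ _ _ _ _ opt_weight_symmetric) opt_total.
rewrite /opt_weight /type_weight; case: ifP => _; first exact: opt1_gt0.
by case: ifP => _; [apply: opt4_gt0|apply: opt2_gt0].
Qed.

(** Kinds 1a, 2b, 3a, 4b, 5a and 5b take the value [l] exactly. Each other kind has the word weight
    of one of these and a smaller or equal complementary mass. *)
Lemma f_rel_opt_weight k p : rel_valid k p -> f_rel k p opt_weight <= l.
Proof.
move=> kp; have [_ x1] := opt_weight_Delta.
rewrite (f_relE _ _ _ _ _ _ opt_weight_symmetric x1 _ _ kp) {kp p}.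
have [N2 l9 m3 ml27] := opt_bounds _ _ _ N_ge2 l_gtm2.
have a_gt0 := opt1_gt0 _ _ _ N_ge2 l_gtm2.
have b_gt0 := opt2_gt0 _ _ _ N_ge2 l_gtm2.
have c_gt0 := opt4_gt0 _ _ _ N_ge2 l_gtm2.
have ac := opt1_le_opt4 _ _ _ N_ge2 l_gtm2.
have fa := odds_ratio_opt1 _ _ _ N_ge2 l_gtm2.
have fb := odds_ratio_opt2 _ _ _ N_ge2 l_gtm2 Pl.
have fc := odds_ratio_opt4 _ _ _ N_ge2 l_gtm2.
have tot := opt_total _ _ _ N_ge2 l_gtm2 Pl.
rewrite -/N in fa fb fc tot *.
set a := opt1 N l in a_gt0 ac fa fb fc tot *.
set b := opt2 N l in b_gt0 fa fb fc tot *.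
set c := opt4 N l in c_gt0 ac fa fb fc tot *.
set d := 2 * N - 2 in fa fb fc tot *.
have d2 : 2 <= d by rewrite /d; lra.
have N0 : 2 * N != 0 by apply/eqP; lra.
have h_gt0 : 0 < 1 / (2 * N) by rewrite divr_gt0 //; lra.
have h_le : 1 / (2 * N) <= 4^-1 by rewrite mul1r lef_pV2 ?posrE; lra.
have totE : a + d * c + d ^+ 2 * b = 1 / (2 * N).
  by rewrite div1r -[LHS](mulKf N0) tot mulr1.
have db_ge : 2 * b <= d * b by rewrite ler_pM2r.
have dc_ge : 2 * c <= d * c by rewrite ler_pM2r.
have ddb_ge : 2 * (d * b) <= d ^+ 2 * b by rewrite expr2 -mulrA ler_pM2r //; lra.
case: k; rewrite ?fa ?fb ?fc //.
(* The remaining kinds are 1b, 2a, 3b and 4a; the mass comparisons are [b <= 1 / (2 * N)],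
   [a <= d * b + c] twice, and [d * b + c <= 1 - 1 / (2 * N)]. *)
- by rewrite -[leRHS]fa; apply: odds_ratio_le_mass; apply/andP; split; lra.
- by rewrite -[leRHS]fb; apply: odds_ratio_le_mass; apply/andP; split; lra.
- by rewrite -[leRHS]fb; apply: odds_ratio_le_mass; apply/andP; split; lra.
- by rewrite -[leRHS]fc; apply: odds_ratio_le_mass; apply/andP; split; lra.
Qed.

End OptimalWeight.

(** * Identification of the minimizer and of both infima *)

Theorem theorem5p10 (R : realType) (n : nat) (alpha : R)
  (xs : psi_raw n -> R) (a b c : R) :
  (2 <= n)%N ->
  Ppoly n alpha = 0 ->
  (2 * n%:R - 1) ^+ 2 < alpha ->
  (forall y : R, (2 * n%:R - 1) ^+ 2 < y -> Ppoly n y = 0 -> y = alpha) ->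
  @Delta R n xs ->
  Fmax xs = inf [set Fmax x | x in @Delta R n] ->
  0 < a < 1 -> 0 < b < 1 -> 0 < c < 1 ->
  (forall w, inPsi w -> psi_type w = 1%N -> xs w = a) ->
  (forall w, inPsi w -> psi_type w \in [:: 2; 3; 5]%N -> xs w = b) ->
  (forall w, inPsi w -> psi_type w = 4%N -> xs w = c) ->
  let N := n%:R : R in
  [/\ a = 1 / ((2 * N - 1) * alpha + 1),
      b = (2 * N - 1) * (alpha - 1) /
          ((4 * N ^+ 2 - 4 * N - 1) * (2 * N - 1) * alpha ^+ 2
           + 2 * (2 * N ^+ 2 - 1) * alpha - (2 * N - 1)),
      c = (2 * N - 1) / (2 * N - 1 + alpha),
      inf [set Fmax x | x in @Delta R n] = alpha &
      inf [set Gmax x | x in @Delta R n] = alpha].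
Proof.
move=> n2 Pa a_gt _ xsD infE /andP[a_gt0 _] /andP[b_gt0 _] /andP[c_gt0 _].
move=> xsa xsb xsc N.
have N2 : 2 <= N by rewrite ler_nat.
have alpha_ge0 : 0 <= alpha by rewrite (le_trans _ (ltW a_gt)) ?sqr_ge0.
have xs_sym : symmetric_weight xs a b c.
  move=> w wP; have := xsa w wP; have := xsb w wP; have := xsc w wP.
  rewrite /type_weight; case: w {wP} => [[u|[u v]]|[[u v] w]] /=.
  - by move=> _ _; apply.
  - by move=> _ + _; apply.
  case: (w == u); first by move=> _ + _; apply.
  by case: (w == flip u) => [+ _ _|_ + _]; apply.
have [_ xs1] := xsD.
pose x0 := opt_weight _ n alpha.
have x0D : Delta x0 by apply: opt_weight_Delta.
have G0 : Gmax x0 <= alpha.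
  by apply: maxrel_le => // k p kp; apply: f_rel_opt_weight.
have Fxs : Fmax xs <= alpha.
  rewrite infE; apply: le_trans (le_trans (Fmax_le_Gmax _ _ x0) G0).
  by apply: ge_inf; [apply: has_lbound_Fmax|exists x0].
(* Two distinct generators exist since [2 <= n], so [p] is a valid parameter for kinds 1a, 2b and
   4b. *)
pose i0 : 'I_n := Ordinal (leq_trans (isT : (0 < 2)%N) n2).
pose i1 : 'I_n := Ordinal n2.
pose p : letter n * letter n * letter n := ((i0, true), (i1, true), (i1, true)).
have fE k (kF : match k with R1a | R2b | R4b => true | _ => false end) :
    f_rel k p xs <= Fmax xs by apply: f_rel_le_Fmax => //; case: k kF.
have f1 := fE R1a isT; have f2 := fE R2b isT; have f4 := fE R4b isT.
rewrite (f_relE _ _ _ _ _ _ xs_sym xs1) // -/N in f1.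
rewrite (f_relE _ _ _ _ _ _ xs_sym xs1) // -/N in f2.
rewrite (f_relE _ _ _ _ _ _ xs_sym xs1) // -/N in f4.
have [ea eb ec] : [/\ a = opt1 N alpha, b = opt2 N alpha & c = opt4 N alpha].
  apply: (optimum_unique _ N) => //.
  - exact: opt1_gt0.
  - exact: opt2_gt0.
  - exact: opt4_gt0.
  - exact: opt2_le_opt4.
  - by rewrite -(sum_inPsi_symmetric _ _ _ _ _ _ xs_sym).
  - exact: opt_total.
  - by rewrite odds_ratio_opt1 // (le_trans f1).
  - by rewrite odds_ratio_opt2 // (le_trans f2).
  - by rewrite odds_ratio_opt4 // (le_trans f4).
have infF : inf [set Fmax x | x in @Delta R n] = alpha.
  rewrite -infE; apply: le_anti; rewrite Fxs /=.
  (* With [a = opt1 N alpha] the relation 1a alone has value [alpha], which bounds [Fmax xs] from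
     below. *)
  by rewrite ea odds_ratio_opt1 // in f1.
split=> //; apply: le_anti; apply/andP; split.
  by apply: le_trans G0; apply: ge_inf; [apply: has_lbound_Gmax|exists x0].
rewrite -[leLHS]infF; apply: lb_le_inf; first by exists (Gmax x0), x0.
move=> _ [x xD <-]; apply: le_trans (Fmax_le_Gmax _ _ x).
by apply: ge_inf; [apply: has_lbound_Fmax|exists x].
Qed.
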